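(* Let $G$ and $H$ be finite simple graphs. If the largest clique of $G$ is $K_n$ and the largest clique of $H$ is $K_m$, then the chromatic number of the product satisfies $c(G\times H)=n+m-1$.
   Context: $c(\cdot)$ denotes the (vertex) chromatic number. Product: for finite simple graphs $G,H$, the graph $G\times H$ has as vertices all pairs $(x,y)$ with $x$ a nonempty complete subgraph (simplex, identified with its vertex set) of $G$ and $y$ a nonempty complete subgraph of $H$. Two distinct vertices $(x,y)\neq(x',y')$ are adjacent iff ($x\subseteq x'$ and $y\subseteq y'$) or ($x'\subseteq x$ and $y'\subseteq y$). The graphs $G$ and $H$ are nonempty, i.e. $n,m\ge 1$. *)

(* Defs.v *)
From mathcomp Require Import all_boot.

Set Implicit Arguments.
Unset Strict Implicit.
Unset Printing Implicit Defensive.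

Record sgraph := SGraph {
  vertex :> finType;
  adj : rel vertex;
  adj_sym : symmetric adj;
  adj_irr : irreflexive adj
}.

(* The empty set is a clique in this sense; [simplex] excludes it. *)
Definition is_clique (G : sgraph) (x : {set G}) : bool :=
  [forall u in x, forall v in x, (u != v) ==> adj u v].

Definition simplex (G : sgraph) : finType :=
  {x : {set G} | (x != set0) && is_clique x}.

Definition clique_number (G : sgraph) : nat :=
  \max_(x : {set G} | is_clique x) #|x|.

Definition proper_coloring (G : sgraph) (k : nat) (f : {ffun G -> 'I_k}) : bool :=
  [forall u, forall v, adj u v ==> (f u != f v)].

Definition colorable (G : sgraph) (k : nat) : bool :=
  [exists f : {ffun G -> 'I_k}, proper_coloring f].

Lemma colorable_ex (G : sgraph) : exists k, colorable G k.
Proof.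
exists #|G|; apply/existsP; exists [ffun u => enum_rank u].
apply/forallP => u; apply/forallP => v; apply/implyP => uv.
rewrite !ffunE (inj_eq enum_rank_inj).
by apply: contraTneq uv => ->; rewrite adj_irr.
Qed.

Definition chromatic_number (G : sgraph) : nat := ex_minn (colorable_ex G).

Section Product.
Variables G H : sgraph.

Definition prod_le (p q : simplex G * simplex H) : bool :=
  (val p.1 \subset val q.1) && (val p.2 \subset val q.2).

Definition prod_adj : rel (simplex G * simplex H) :=
  fun p q => (p != q) && (prod_le p q || prod_le q p).

Lemma prod_adj_sym : symmetric prod_adj.
Proof. by move=> p q; rewrite /prod_adj eq_sym orbC. Qed.

Lemma prod_adj_irr : irreflexive prod_adj.
Proof. by move=> p; rewrite /prod_adj eqxx. Qed.

Definition graph_prod : sgraph := SGraph prod_adj_sym prod_adj_irr.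

End Product.

(* Main.v *)
(** Comparable simplex pairs are distinguished by [#|x| + #|y|], which takes
    [n + m - 1] values; conversely the prefixes of a maximum clique of each
    factor form chains of lengths [n] and [m], and walking up the first and then
    up the second gives [n + m - 1] pairwise adjacent vertices of the product. *)
Require Import Defs.
From mathcomp Require Import all_boot.
From mathcomp Require Import zify.

Lemma chromatic_number_le (G : sgraph) (k : nat) (f : G -> nat) :
  (forall u, f u < k) -> (forall u v, adj u v -> f u != f v) ->
  chromatic_number G <= k.
Proof.
move=> f_lt f_adj; rewrite /chromatic_number; case: ex_minnP => c _; apply.
apply/existsP; exists [ffun u => Ordinal (f_lt u)].
apply/forallP => u; apply/forallP => v; apply/implyP => uv.
by rewrite !ffunE -val_eqE f_adj.
Qed.

(** A proper colouring is injective along a pairwise adjacent family, so it uses at least [k]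
    colours. *)
Lemma chromatic_number_ge (G : sgraph) (k : nat) (p : 'I_k -> G) :
  (forall i j : 'I_k, i < j -> adj (p i) (p j)) -> k <= chromatic_number G.
Proof.
move=> p_adj; rewrite /chromatic_number.
case: ex_minnP => c /existsP[f f_proper] _.
have f_adj u v : adj u v -> f u != f v.
  by move=> uv; move/forallP/(_ u)/forallP/(_ v)/implyP: f_proper; apply.
suff f_p_inj : injective (f \o p) by have := leq_card _ f_p_inj; rewrite !card_ord.
move=> i j /= fij; apply/val_inj; case: (ltngtP i j) => // ij.
  by have := f_adj _ _ (p_adj _ _ ij); rewrite fij eqxx.
by have := f_adj _ _ (p_adj _ _ ij); rewrite fij eqxx.
Qed.

Lemma is_clique_sub (G : sgraph) (x y : {set G}) :
  x \subset y -> is_clique y -> is_clique x.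
Proof.
move=> /subsetP xy /'forall_in_forall_inP y_clique.
by apply/'forall_in_forall_inP => u ux v vx; apply: y_clique; apply: xy.
Qed.

Lemma card_simplex_gt0 (G : sgraph) (x : simplex G) : 0 < #|val x|.
Proof. by rewrite card_gt0; case/andP: (valP x). Qed.

Lemma card_simplex_le (G : sgraph) (x : simplex G) :
  #|val x| <= clique_number G.
Proof. by case/andP: (valP x) => _ ?; apply: leq_bigmax_cond. Qed.

Lemma max_clique_ex (G : sgraph) :
  exists2 x : {set G}, is_clique x & #|x| = clique_number G.
Proof.
have clique0 : is_clique (set0 : {set G}).
  by apply/forallP => u; rewrite inE.
rewrite /clique_number (bigmax_eq_arg _ clique0) //.
by case: arg_maxnP => // x; exists x.
Qed.

(** Prefixes of an enumeration of a maximum clique are cliques. Past the end the prefix stays the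
    whole clique, so monotonicity holds for all indices while the cardinality formula needs a
    bound. *)
Lemma simplex_chain (G : sgraph) : 0 < clique_number G ->
  exists s : nat -> simplex G,
    (forall i, i < clique_number G -> #|val (s i)| = i.+1) /\
    (forall i j, i <= j -> val (s i) \subset val (s j)).
Proof.
have [x x_clique <-] := max_clique_ex G; move=> x_gt0.
(* The shift to [i.+1] keeps the prefix at index 0 nonempty. *)
pose t i : {set G} := [set u in take i.+1 (enum x)].
have card_t i : #|t i| = minn i.+1 #|x|.
  by rewrite cardsE (card_uniqP _) ?take_uniq ?enum_uniq // size_take_min -cardE.
have t_simplex i : (t i != set0) && is_clique (t i).
  rewrite -card_gt0 card_t leq_min x_gt0 /=; apply: is_clique_sub x_clique.
  by apply/subsetP => u; rewrite inE => /mem_take; rewrite mem_enum.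
exists (fun i => Sub (t i) (t_simplex i)); split=> [i i_lt | i j ij].
  by rewrite SubK card_t; apply/minn_idPl.
rewrite !SubK; apply/subsetP => u; rewrite !inE.
by rewrite -(@take_takel _ i.+1 j.+1) // => /mem_take.
Qed.

(** Neither cardinality can drop along an inclusion, so a total that does not grow forces equality
    in both coordinates. *)
Lemma prod_le_card_eq (G H : sgraph) (p q : simplex G * simplex H) :
  prod_le p q -> #|val q.1| + #|val q.2| <= #|val p.1| + #|val p.2| -> p = q.
Proof.
case: p q => [x y] [x' y'] /andP[/= xx' yy'] le_card.
have := subset_leq_card xx'; have := subset_leq_card yy' => ley lex.
congr pair; apply/val_inj/eqP; rewrite eqEcard ?xx' ?yy' /=; lia.
Qed.

Theorem theorem24 (G H : sgraph) (n m : nat)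
    (n_ge1 : 1 <= n) (m_ge1 : 1 <= m)
    (largest_clique_G : clique_number G = n)
    (largest_clique_H : clique_number H = m) :
  chromatic_number (graph_prod G H) = n + m - 1.
Proof.
apply/eqP; rewrite eqn_leq; apply/andP; split.
  (* Simplices are nonempty, so the total size lies between 2 and [n + m]; subtracting 2 makes the
     colours start at 0. *)
  apply: (@chromatic_number_le (graph_prod G H) _
            (fun p => #|val p.1| + #|val p.2| - 2)) => [[x y] | p q].
    have := card_simplex_gt0 _ x; have := card_simplex_gt0 _ y.
    have := card_simplex_le _ x; have := card_simplex_le _ y.
    rewrite largest_clique_G largest_clique_H /=; lia.
  case/andP => pq comparable; apply: contraNneq pq => eq_card.
  (* Positivity ensures that the truncated subtraction of 2 does not merge distinct totals. *)
  have := card_simplex_gt0 _ p.1; have := card_simplex_gt0 _ q.1.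
  have := card_simplex_gt0 _ p.2; have := card_simplex_gt0 _ q.2.
  move=> q2 p2 q1 p1; apply/eqP; case/orP: comparable => le.
    by apply: prod_le_card_eq le _; lia.
  by apply/esym; apply: prod_le_card_eq le _; lia.
have [|s [card_s s_mono]] := @simplex_chain G; first by rewrite largest_clique_G.
have [|t [card_t t_mono]] := @simplex_chain H; first by rewrite largest_clique_H.
rewrite largest_clique_G in card_s; rewrite largest_clique_H in card_t.
(* Truncated subtraction holds the second coordinate at [t 0] until the first reaches its top
   [s n.-1], where [minn] then freezes it. *)
pose p (i : nat) : graph_prod G H := (s (minn i n.-1), t (i - n.-1)).
apply: (@chromatic_number_ge (graph_prod G H) _
          (fun i : 'I_(n + m - 1) => p i)) => i j ij.
(* The two indices add up to [k], and each size exceeds its index by one. The total thus determines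
   [k], which makes the vertices distinct. *)
have card_p (k : 'I_(n + m - 1)) : #|val (p k).1| + #|val (p k).2| = k.+2.
  have := ltn_ord k => k_lt; rewrite /= card_s ?card_t; lia.
apply/andP; split.
  apply: contraTneq ij => pij.
  by have := card_p i; rewrite pij card_p; lia.
by apply/orP; left; rewrite /prod_le /= s_mono ?t_mono //; lia.
Qed.
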